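(* For all positive integers $t,r$, $\operatorname{im}(K_t\times K_r)=(t-1)(r-1)+1$.
   Context: All graphs are finite and simple. A graph $G$ has a $G'$-immersion if there is an injective map $\phi:V(G')\to V(G)$ such that for every edge $uv\in E(G')$ there is a path in $G$ joining $\phi(u)$ and $\phi(v)$, and these paths are pairwise edge-disjoint. The immersion number $\operatorname{im}(G)$ is the largest $t$ such that $G$ has a $K_t$-immersion. The direct product $G\times H$ has vertex set $V(G)\times V(H)$, with $(g,h)$ adjacent to $(g',h')$ if and only if $gg'\in E(G)$ and $hh'\in E(H)$. $K_n$ denotes the complete graph on $n$ vertices. *)

(* Defs.v *)
From mathcomp Require Import all_boot.
From mathcomp Require Import boolp.
Set Implicit Arguments.
Unset Strict Implicit.
Unset Printing Implicit Defensive.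

Record sgraph := SGraph {
  vert :> finType;
  adj : rel vert;
  adj_sym : symmetric adj;
  adj_irrefl : irreflexive adj }.

Definition edges (G : sgraph) : {set {set G}} :=
  [set [set p.1; p.2] | p : G * G & adj p.1 p.2].

Section Complete.
Variable n : nat.

Definition complete_adj : rel 'I_n := fun i j => i != j.

Lemma complete_sym : symmetric complete_adj.
Proof. by move=> i j; rewrite /complete_adj eq_sym. Qed.

Lemma complete_irrefl : irreflexive complete_adj.
Proof. by move=> i; rewrite /complete_adj eqxx. Qed.

Definition complete : sgraph := SGraph complete_sym complete_irrefl.
End Complete.

Section DirectProduct.
Variables G H : sgraph.

Definition direct_adj : rel (G * H)%type :=
  fun x y => adj x.1 y.1 && adj x.2 y.2.

Lemma direct_sym : symmetric direct_adj.
Proof.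
by move=> x y; rewrite /direct_adj (adj_sym x.1) (adj_sym x.2).
Qed.

Lemma direct_irrefl : irreflexive direct_adj.
Proof. by move=> x; rewrite /direct_adj adj_irrefl. Qed.

Definition direct_product : sgraph := SGraph direct_sym direct_irrefl.
End DirectProduct.

(* A path is given by the sequence of its (pairwise distinct) vertices; the   *)
(* ends are compared as a set because paths are unoriented.                   *)
Definition path_joining (G : sgraph) (a b : G) (s : seq G) : Prop :=
  exists x p, [/\ s = x :: p, path (@adj G) x p, uniq (x :: p)
                & [set x; last x p] = [set a; b]].

Definition path_edges (G : sgraph) (s : seq G) : seq {set G} :=
  [seq [set xy.1; xy.2] | xy <- zip s (behead s)].

(* The paths are indexed by the (unordered) edges of G'.                      *)
Definition has_immersion (G G' : sgraph) : Prop :=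
  exists (phi : G' -> G) (P : {set G'} -> seq G),
    [/\ injective phi,
        forall u v : G', adj u v ->
          path_joining (phi u) (phi v) (P [set u; v])
      & forall e f : {set G'}, e \in edges G' -> f \in edges G' -> e != f ->
          forall d : {set G},
            ~ (d \in path_edges (P e) /\ d \in path_edges (P f))].

(* Since phi is injective, no K_t with t > #|G| is immersed in G, so this     *)
(* bounded maximum is the largest such t (im_immersion and im_max below).     *)
Definition im (G : sgraph) : nat :=
  \max_(t < #|G|.+1 | `[< has_immersion G (complete t) >]) t.

Lemma immersion_card (G : sgraph) (t : nat) :
  has_immersion G (complete t) -> t <= #|G|.
Proof.
by case=> phi [P [phi_inj _ _]]; rewrite -{1}(card_ord t); apply: leq_card phi_inj.
Qed.

Lemma immersion0 (G : sgraph) : has_immersion G (complete 0).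
Proof.
have phi : complete 0 -> G by case.
exists phi, (fun=> [::]).
by split=> [[]|[]|e f _ _ _ d []] //; rewrite /path_edges.
Qed.

Lemma im_immersion (G : sgraph) : has_immersion G (complete (im G)).
Proof.
rewrite /im; have [t /asboolP t_im ->] :
  {t : 'I_#|G|.+1 | `[< has_immersion G (complete t) >]
     & \max_(t < #|G|.+1 | `[< has_immersion G (complete t) >]) t = t :> nat}.
  by apply: eq_bigmax_cond; apply/card_gt0P; exists ord0; apply/asboolP/immersion0.
exact: t_im.
Qed.

Lemma im_max (G : sgraph) (t : nat) : has_immersion G (complete t) -> t <= im G.
Proof.
move=> t_im; have t_lt : t < #|G|.+1 by rewrite ltnS immersion_card.
by apply: (leq_bigmax_cond (Ordinal t_lt)); apply/asboolP.
Qed.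

(* Main.v *)
Require Import Defs.
From mathcomp Require Import all_boot zify.

(* The product is (t-1)(r-1)-regular, which gives the upper bound. For the    *)
(* lower bound the branch vertices are (0,0) and all (i,j) with i, j > 0, so  *)
(* that only pairs in a common row or column are not adjacent. A pair in row  *)
(* i is joined through a vertex (0,b), and a pair in column j through a       *)
(* vertex (a,0), where b and a are the colours of the pair in proper edge     *)
(* colourings of K_(r-1) and K_(t-1) in which x never meets the colour x.     *)
(* On an odd number of vertices a near 1-factorization does this. On an even  *)
(* number a perfect matching remains uncoloured, and each x misses a second   *)
(* colour, its spare, with x |-> spare x injective. If t-1 and r-1 are both   *)
(* even, the uncoloured pairs of row i go through (spare i,0) and those of    *)
(* column j through (0,spare j). If only r-1 is even, the uncoloured pair     *)
(* j, j' of row i follows (i,j) (0,spare j) (i,0) (0,spare j') (i,j'), and    *)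
(* symmetrically if only t-1 is even.                                         *)

Set Implicit Arguments.
Unset Strict Implicit.
Unset Printing Implicit Defensive.

(** For the upper bound, [immersion_degree] counts the edges at one branch vertex. For the lower
    bound, disjointness is not checked path against path: [owner] assigns each edge of the product
    to one pair of vertices, [route] joins every two branch vertices by a path whose edges their
    pair owns, and [immersion_of_owner] concludes. The assignment is consistent because the edge
    from (i,j) to (0,b) is claimed only by the row pair of colour b at j, unless b is the spare
    colour of j, which leaves it free for an uncoloured pair; columns are symmetric. [ord_pairing]
    supplies the colourings. *)

Lemma set2_inj (T : finType) (a b x y : T) :
  [set a; b] = [set x; y] -> a = x /\ b = y \/ a = y /\ b = x.
Proof.
move=> eqs; have : a \in [set x; y] by rewrite -eqs set21.
have : b \in [set x; y] by rewrite -eqs set22.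
have : x \in [set a; b] by rewrite eqs set21.
have : y \in [set a; b] by rewrite eqs set22.
clear eqs; rewrite !inE.
by move=> /orP[]/eqP ? /orP[]/eqP ? /orP[]/eqP ? /orP[]/eqP ?; subst; auto.
Qed.

(** * The degree bound *)

Lemma path_edgesP (G : sgraph) (s : seq G) (d : {set G}) :
  reflect (exists2 xy, xy \in zip s (behead s) & d = [set xy.1; xy.2])
          (d \in path_edges s).
Proof. exact: mapP. Qed.

Lemma path_last_edge (G : sgraph) (x : G) p : path (@adj G) x p -> p != [::] ->
  exists2 w, adj (last x p) w & [set last x p; w] \in path_edges (x :: p).
Proof.
elim: p x => //= y p IHp x /andP[xy yp] _; have [p0|pN0] := eqVneq p [::].
  by exists x; rewrite p0 /= 1?adj_sym // setUC inE eqxx.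
have [w wadj win] := IHp y yp pN0.
by exists w => //; rewrite /path_edges /= inE win orbT.
Qed.

Lemma path_joining_edge (G : sgraph) (a b : G) s : a != b ->
  path_joining a b s -> exists2 w, adj a w & [set a; w] \in path_edges s.
Proof.
move=> aNb [x [p [-> xp _ /set2_inj ends]]].
have pN0 : p != [::].
  apply: contraNneq aNb => p0; move: ends; rewrite p0 /=.
  by move=> [[<- <-]|[<- <-]].
case: ends => [[<- _]|[_ <-]]; last exact: path_last_edge.
case: p xp pN0 => //= y p /andP[xy _] _.
by exists y => //; rewrite /path_edges /= inE eqxx.
Qed.

Lemma in_edges_complete n (u v : 'I_n) :
  u != v -> [set u; v] \in edges (complete n).
Proof. by move=> uNv; apply/imsetP; exists (u, v); rewrite ?inE. Qed.

(* The paths that end at a given branch vertex do so along distinct edges.    *)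
Lemma immersion_degree (G : sgraph) n D :
    (forall v : G, #|[set w | adj v w]| <= D) ->
  has_immersion G (complete n) -> n <= D.+1.
Proof.
case: n => // n degD [phi [P [phi_inj Pjoin Pdisj]]].
pose u0 : 'I_n.+1 := ord0; pose c := phi u0.
have edge v : exists w, v != u0 ->
    adj c w /\ [set c; w] \in path_edges (P [set u0; v]).
  have [->|vNu] := eqVneq v u0; first by exists c.
  have cNv : c != phi v by rewrite (inj_eq phi_inj) eq_sym.
  have uv : adj (u0 : complete n.+1) v by rewrite /= /complete_adj eq_sym.
  by have [w] := path_joining_edge cNv (Pjoin _ _ uv); exists w.
have [f fP] := fin_all_exists edge.
have f_inj : {in [set~ u0] &, injective f}.
  move=> v w; rewrite !inE => vN wN fvw.
  have [//|vNw] := eqVneq v w.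
  have [[_ fv] [_ fw]] := (fP v vN, fP w wN).
  have eN : [set u0; v] != [set u0; w].
    apply: contra_neq vNw => /set2_inj[[_ //]|[u0w vu0]].
    by rewrite vu0 u0w.
  case: (Pdisj _ _ _ _ eN [set c; f v]).
  - by apply: in_edges_complete; rewrite eq_sym.
  - by apply: in_edges_complete; rewrite eq_sym.
  by rewrite fv fvw.
have <- : #|[set~ u0]| = n by rewrite cardsC1 card_ord.
rewrite ltnS -(card_in_imset f_inj) (leq_trans _ (degD c)) //.
apply: subset_leq_card; apply/subsetP=> _ /imsetP[v vN ->].
by rewrite !inE in vN *; have [] := fP v vN.
Qed.

Lemma product_degree m n (v : direct_product (complete m) (complete n)) :
  #|[set w | adj v w]| = (m - 1) * (n - 1).
Proof.
have -> : [set w | adj v w] = setX [set~ v.1] [set~ v.2].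
  apply/setP=> w.
  by rewrite !inE /= /direct_adj /= /complete_adj (eq_sym w.1) (eq_sym w.2).
by rewrite cardsX !cardsC1 !card_ord -!subn1.
Qed.

(** * Building and transporting immersions *)

(** An edge common to two paths has a single owner, so the two paths have the same pair of ends. *)
Lemma immersion_of_owner (G : sgraph) n (phi : 'I_n -> G)
    (Q : 'I_n -> 'I_n -> seq G) (own : G -> G -> {set G}) :
    injective phi ->
    (forall x y, own x y = own y x) ->
    (forall u v, u != v -> path_joining (phi u) (phi v) (Q u v)) ->
    (forall u v, u != v ->
       {in zip (Q u v) (behead (Q u v)),
          forall xy, own xy.1 xy.2 = [set phi u; phi v]}) ->
  has_immersion G (complete n).
Proof.
move=> phi_inj ownC Qjoin Qown.
(* Paths are indexed by unordered edges; [pick] chooses an orientation. *)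
pose P (e : {set 'I_n}) : seq G :=
  if [pick p : 'I_n * 'I_n | (p.1 != p.2) && (e == [set p.1; p.2])] is Some p
  then Q p.1 p.2 else [::].
have PE u v : u != v -> exists u' v',
    [/\ u' != v', [set u; v] = [set u'; v'] & P [set u; v] = Q u' v'].
  move=> uNv; rewrite /P; case: pickP => [[u' v'] /= /andP[? /eqP ?]|].
    by exists u', v'.
  by move/(_ (u, v)); rewrite /= uNv eqxx.
have setphi u v u' v' : [set u; v] = [set u'; v'] ->
    [set phi u; phi v] = [set phi u'; phi v'].
  by case/set2_inj => [[-> ->]|[-> ->]] //; rewrite setUC.
exists phi, P; split=> // [u v /= uNv|].
  have [u' [v' [uNv' es ->]]] := PE u v uNv.
  have [x [p [-> xp xu ends]]] := Qjoin u' v' uNv'.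
  by exists x, p; split=> //; rewrite ends; apply/esym/setphi.
move=> _ _ /imsetP[[u v] /= uv ->] /imsetP[[w z] /= wz ->] neq d [].
rewrite !inE /= in uv wz.
have [u1 [v1 [uNv1 es1 ->]]] := PE u v uv.
have [w1 [z1 [wNz1 es2 ->]]] := PE w z wz.
move=> /path_edgesP[[x y] xy ->] /path_edgesP[[x' y'] xy' eqd].
suff eqphi : [set phi u1; phi v1] = [set phi w1; phi z1].
  case/negP: neq; apply/eqP; rewrite es1 es2.
  by case/set2_inj: eqphi => [[/phi_inj-> /phi_inj->]|[/phi_inj-> /phi_inj->]];
    rewrite // setUC.
rewrite -(Qown _ _ uNv1 _ xy) -(Qown _ _ wNz1 _ xy') /=.
by case/set2_inj: eqd => /= [[-> ->]|[-> ->]].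
Qed.

Lemma immersion_hom (G H K : sgraph) (f : H -> G) :
    injective f -> (forall x y, adj x y -> adj (f x) (f y)) ->
  has_immersion H K -> has_immersion G K.
Proof.
move=> f_inj f_hom [phi [P [phi_inj Pjoin Pdisj]]].
have fset2 x y : f @: [set x; y] = [set f x; f y] by rewrite imsetU !imset_set1.
exists (f \o phi), (fun e => map f (P e)); split; first exact: inj_comp.
  move=> u v /Pjoin[x [p [-> xp xu ends]]]; exists (f x), (map f p); split=> //.
  - rewrite path_map; apply: sub_path xp; exact: f_hom.
  - by rewrite -map_cons map_inj_uniq.
  by rewrite last_map -!fset2 ends.
have edge_im s d : d \in path_edges (map f s) ->
    exists2 d', d' \in path_edges s & d = f @: d'.
  rewrite /path_edges behead_map => /mapP[xy].
  have -> : zip (map f s) (map f (behead s)) =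
            [seq (f p.1, f p.2) | p <- zip s (behead s)].
    elim: s (behead s) => [|x s IHs] [|y t] //=; by rewrite IHs.
  case/mapP=> p ps -> ->; exists [set p.1; p.2]; last by rewrite fset2.
  exact: map_f.
move=> e e' eE eE' eN d [/edge_im[d1 d1P ->] /edge_im[d2 d2P /(imset_inj f_inj) d12]].
by apply: (Pdisj e e' eE eE' eN d1); rewrite {2}d12.
Qed.

(* A proper edge colouring of the complete graph on T, minus a perfect        *)
(* matching [partner] unless [total], with colours in T: [mate b] matches the *)
(* ends of the edges of colour b, and x meets neither the colour x nor the    *)
(* colour [spare x].                                                          *)
Record pairing (T : finType) := Pairing {
  total : bool;
  mate : T -> T -> T;
  partner : T -> T;
  spare : T -> T;
  unspare : T -> T;
  spareK : cancel spare unspare;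
  pairingP : forall x y, x != y ->
    (exists b, [/\ b != x, b != y, b != spare x, b != spare y
                 & mate b x = y /\ mate b y = x]) \/
    [/\ ~~ total, partner x = y & partner y = x];
  spare_neq : ~~ total -> forall x, spare x != x }.

(** * Cyclic edge colourings *)

Section CyclicPairing.
Variable m : nat.

Definition cyc_dist b x := if b <= x then x - b else x + m - b.
Definition cyc_wrap s := if s < m then s else s - m.

(** The reflection of x in b modulo [m]. *)
Definition odd_mate b x := cyc_wrap (b + (m - cyc_dist b x)).

Lemma odd_mateP x y : odd m -> x < y < m ->
  exists b, [/\ b < m, b != x, b != y, odd_mate b x = y & odd_mate b y = x].
Proof.
rewrite /odd_mate /cyc_wrap /cyc_dist => odd_m xym.
(* As [m] is odd, one of the two arcs between x and y has even length; b is its midpoint. *)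
have [q [Dq|Dq]] : exists q, y - x = q.*2 \/ y - x = q.*2.+1.
- by exists (y - x)./2; lia.
- by exists (x + q); split; do ?case: ifP; lia.
have [p Dp] : exists p, m - (y - x) = p.*2 by exists (m - (y - x))./2; lia.
have [bm|bm] := ltnP (y + p) m.
- by exists (y + p); split; do ?case: ifP; lia.
by exists (y + p - m); split; do ?case: ifP; lia.
Qed.

(* The residues at distance at most E from b are reflected in b; the residue  *)
(* b - E - 1 is left out, and the remaining ones form an interval of even     *)
(* length, which is reflected in its centre. The two reflections yield each   *)
(* even and each odd difference below m / 2 once: an even starter.            *)
Definition even_mate E b x :=
  let d := cyc_dist b x in
  cyc_wrap (b + (if (d <= E) || (m - E <= d) then m - d else m.-1 - d)).

Lemma even_mateP k E x y :
    m = k.*2 -> k = E.*2.+1 \/ k = E.*2.+2 -> x < y < m -> y - x != k ->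
  exists b, [/\ b < m, b != x, b != y
    & [/\ b != cyc_wrap (x + E.+1), b != cyc_wrap (y + E.+1),
          even_mate E b x = y & even_mate E b y = x]].
Proof.
rewrite /even_mate /cyc_wrap /cyc_dist => Dm DE xym nk.
have [q Dq] : exists q, y - x = q.*2 \/ y - x = q.*2.+1
  by exists (y - x)./2; lia.
(* If the shorter arc is even, b is its midpoint; if odd, the distances of x and y from b add up to
   m - 1. *)
have [lt|ge] := ltnP (y - x) k; case: Dq => Dq.
- by exists (x + q); split=> //; try split; do ?case: ifP; lia.
- have [le|gt] := leqP (k - q.+1) x.
  + by exists (x - (k - q.+1)); split=> //; try split; do ?case: ifP; lia.
  by exists (x + m - (k - q.+1)); split=> //; try split; do ?case: ifP; lia.
- have [bm|bm] := ltnP (y + (k - q)) m.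
  + by exists (y + (k - q)); split=> //; try split; do ?case: ifP; lia.
  by exists (y + (k - q) - m); split=> //; try split; do ?case: ifP; lia.
by exists (y - q); split=> //; try split; do ?case: ifP; lia.
Qed.

Definition ord_fun (f : nat -> nat) (x : 'I_m) : 'I_m := insubd x (f x).

Lemma val_ord_fun (f : nat -> nat) (x : 'I_m) : f x < m -> ord_fun f x = f x :> nat.
Proof. by move=> fx; rewrite [LHS]val_insubd fx. Qed.

Lemma odd_pairing : odd m -> pairing 'I_m.
Proof.
move=> odd_m.
apply: (@Pairing _ true (fun b : 'I_m => ord_fun (odd_mate b)) id id id) => //.
move=> x y xNy; left.
wlog lt_xy : x y xNy / x < y.
  move=> wl; have [/wl|/wl|/val_inj/eqP] := ltngtP x y; first exact.
    by rewrite eq_sym => /(_ xNy)[b [? ? ? ? []]]; exists b.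
  by rewrite (negbTE xNy).
have [|b [bm bx by_ mx my]] := odd_mateP (x := x) (y := y) odd_m.
  by rewrite lt_xy ltn_ord.
exists (Ordinal bm); split=> //; split; apply: ord_inj;
  by rewrite val_ord_fun /= ?mx ?my.
Qed.

Lemma even_pairing : ~~ odd m -> pairing 'I_m.
Proof.
move=> even_m; pose k := m./2; pose E := k.-1./2.
have Dm : m = k.*2 by rewrite /k; lia.
(* An element of ['I_m] excludes k = 0. *)
have DE (x : 'I_m) : k = E.*2.+1 \/ k = E.*2.+2.
  by have := ltn_ord x; rewrite /E; lia.
apply: (@Pairing _ false (fun b : 'I_m => ord_fun (even_mate E b))
  (ord_fun (fun x => cyc_wrap (x + k))) (ord_fun (fun x => cyc_wrap (x + E.+1)))
  (ord_fun (fun x => cyc_wrap (x + (m - E.+1))))).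
- move=> x; have xm := ltn_ord x; have DEx := DE x; clearbody E k.
  have gx : cyc_wrap (x + E.+1) < m by rewrite /cyc_wrap; case: ifP; lia.
  have Dg := @val_ord_fun (fun x => cyc_wrap (x + E.+1)) x gx.
  by apply: ord_inj; rewrite val_ord_fun Dg /cyc_wrap; do ?case: ifP; lia.
- move=> x y xNy.
  wlog lt_xy : x y xNy / x < y.
    move=> wl; have [/wl|/wl|/val_inj/eqP] := ltngtP x y; first exact.
      rewrite eq_sym => /(_ xNy)[[b [? ? ? ? []]]|[]]; last by right.
      by left; exists b.
    by rewrite (negbTE xNy).
  have xm := ltn_ord x; have ym := ltn_ord y; have DEx := DE x.
  clearbody E k; have [xyk|xyk] := eqVneq (y - x) k.
    by right; split=> //; apply: ord_inj; rewrite val_ord_fun /cyc_wrap;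
      do ?case: ifP; lia.
  have [|b [bm bx by_ [gx gy mx my]]] := even_mateP Dm DEx _ xyk.
    by rewrite lt_xy ym.
  have neq_spare (z : 'I_m) : b != cyc_wrap (z + E.+1) ->
      Ordinal bm != ord_fun (fun x => cyc_wrap (x + E.+1)) z.
    apply: contra_neq => /(congr1 (@nat_of_ord m))/= ->; rewrite val_ord_fun //.
    by have := ltn_ord z; rewrite /cyc_wrap; case: ifP; lia.
  left; exists (Ordinal bm); split=> //; try exact: neq_spare.
  by split; apply: ord_inj; rewrite val_ord_fun /= ?mx ?my.
- move=> _ x; have xm := ltn_ord x; have DEx := DE x; clearbody E k.
  apply/negP => /eqP/(congr1 (@nat_of_ord m)).
  by rewrite val_ord_fun /cyc_wrap; do ?case: ifP; lia.
Qed.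

Lemma ord_pairing : pairing 'I_m.
Proof. by have [/odd_pairing|/even_pairing] := boolP (odd m). Qed.
End CyclicPairing.

(** * Routing in the product *)

Lemma eq_some (T : eqType) (x y : T) : (Some x == Some y) = (x == y).
Proof. by []. Qed.

Section CompleteOn.
Variable T : finType.

Definition neq_rel : rel T := fun x y => x != y.

Lemma neq_rel_sym : symmetric neq_rel.
Proof. by move=> x y; rewrite /neq_rel eq_sym. Qed.

Lemma neq_rel_irrefl : irreflexive neq_rel.
Proof. by move=> x; rewrite /neq_rel eqxx. Qed.

Definition complete_on : sgraph := SGraph neq_rel_sym neq_rel_irrefl.
End CompleteOn.

Section Routing.
Variables (A B : finType) (p : pairing A) (q : pairing B).

Notation V := (direct_product (complete_on (option A)) (complete_on (option B))).
Implicit Types (i a : A) (j b : B).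

Definition inner i j : V := (Some i, Some j).
Definition top b : V := (None, Some b).
Definition side a : V := (Some a, None).

Definition branch (x : option (A * B)) : V :=
  if x is Some (i, j) then inner i j else (None, None).

Definition row_pair i j : {set V} := [set inner i j; inner i (partner q j)].
Definition col_pair i j : {set V} := [set inner i j; inner (partner p i) j].

(** No coloured row path uses the edge to [top (spare q j)], so it is reserved for uncoloured
    pairs. *)
Definition top_owner i j b : {set V} :=
  if b == spare q j then if total p then row_pair i j else col_pair i j
  else [set inner i j; inner i (mate q b j)].

Definition side_owner i j a : {set V} :=
  if a == spare p i then if total q then col_pair i j else row_pair i j
  else [set inner i j; inner (mate p a i) j].

(** Only the long paths use these edges; [unspare] recovers the branch vertex from which the path
    came. *)
Definition cross_owner a b : {set V} :=
  if total p then row_pair a (unspare q b) else col_pair (unspare p a) b.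

(* [owner x y] is the pair of ends of the path that uses the edge xy.         *)
Definition owner (x y : V) : {set V} :=
  match x, y with
  | (Some i, Some j), (None, Some b)
  | (None, Some b), (Some i, Some j) => top_owner i j b
  | (Some i, Some j), (Some a, None)
  | (Some a, None), (Some i, Some j) => side_owner i j a
  | (Some a, None), (None, Some b)
  | (None, Some b), (Some a, None) => cross_owner a b
  | _, _ => [set x; y]
  end.

Lemma ownerC x y : owner x y = owner y x.
Proof. by case: x y => [[i|] [j|]] [[i'|] [j'|]] //=; rewrite setUC. Qed.

Definition routed (x y : V) (s : seq V) : Prop :=
  path_joining x y s /\
  {in zip s (behead s), forall xy, owner xy.1 xy.2 = [set x; y]}.

Lemma routed_path (x y : V) s : path (@adj V) x (rcons s y) ->
    uniq (x :: rcons s y) ->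
    all (fun zt => owner zt.1 zt.2 == [set x; y])
        (zip (x :: rcons s y) (rcons s y)) ->
  routed x y (x :: rcons s y).
Proof.
move=> xs xu /allP own; split; last by move=> zt /own/eqP.
by exists x, (rcons s y); split; rewrite ?last_rcons.
Qed.

Lemma route_row i j j' : j != j' -> exists s, routed (inner i j) (inner i j') s.
Proof.
move=> jN; case: (pairingP q jN) => [[b [bj bj' bs bs' [mj mj']]]|[tq pj pj']].
- exists (inner i j :: rcons [:: top b] (inner i j')); apply: routed_path.
  + by rewrite /= /direct_adj /= /neq_rel !eq_some eq_sym bj bj'.
  + by rewrite /= !inE !xpair_eqE /= !eq_some eqxx (negbTE jN).
  by rewrite /= /top_owner (negbTE bs) (negbTE bs') mj mj' !eqxx setUC eqxx.
(* For total [p], [spare p i] may equal i, and [side (spare p i)] is then not adjacent to row i;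
   hence the long path. *)
have [tp|tp] := boolP (total p).
  exists (inner i j :: rcons [:: top (spare q j); side i; top (spare q j')] (inner i j')).
  apply: routed_path.
  - by rewrite /= /direct_adj /= /neq_rel !eq_some eq_sym !spare_neq.
  - rewrite /= !inE !xpair_eqE /= !eq_some !eqxx (negbTE jN) /=.
    by rewrite (inj_eq (can_inj (spareK q))) (negbTE jN).
  rewrite /= /top_owner /cross_owner tp !eqxx !spareK /row_pair pj pj' !eqxx.
  by rewrite setUC eqxx.
exists (inner i j :: rcons [:: side (spare p i)] (inner i j')); apply: routed_path.
- by rewrite /= /direct_adj /= /neq_rel !eq_some eq_sym !spare_neq.
- by rewrite /= !inE !xpair_eqE /= !eq_some eqxx (negbTE jN) !andbF.
by rewrite /= /side_owner (negbTE tq) !eqxx /row_pair pj pj' eqxx setUC eqxx.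
Qed.

Lemma route_col i i' j : i != i' -> exists s, routed (inner i j) (inner i' j) s.
Proof.
move=> iN; case: (pairingP p iN) => [[a [ai ai' as_ as' [mi mi']]]|[tp pi pi']].
- exists (inner i j :: rcons [:: side a] (inner i' j)); apply: routed_path.
  + by rewrite /= /direct_adj /= /neq_rel !eq_some eq_sym ai ai'.
  + by rewrite /= !inE !xpair_eqE /= !eq_some eqxx (negbTE iN) ?andbF.
  by rewrite /= /side_owner (negbTE as_) (negbTE as') mi mi' !eqxx setUC eqxx.
have [tq|tq] := boolP (total q).
  exists (inner i j :: rcons [:: side (spare p i); top j; side (spare p i')] (inner i' j)).
  apply: routed_path.
  - by rewrite /= /direct_adj /= /neq_rel !eq_some eq_sym !spare_neq.
  - rewrite /= !inE !xpair_eqE /= !eq_some !eqxx (negbTE iN) ?andbF /=.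
    by rewrite (inj_eq (can_inj (spareK p))) (negbTE iN).
  rewrite /= /side_owner /cross_owner tq (negbTE tp) !eqxx !spareK /col_pair pi pi' !eqxx.
  by rewrite setUC eqxx.
exists (inner i j :: rcons [:: top (spare q j)] (inner i' j)); apply: routed_path.
- by rewrite /= /direct_adj /= /neq_rel !eq_some eq_sym !spare_neq.
- by rewrite /= !inE !xpair_eqE /= !eq_some eqxx (negbTE iN) ?andbF.
by rewrite /= /top_owner (negbTE tp) !eqxx /col_pair pi pi' eqxx setUC eqxx.
Qed.

Lemma route x y : x != y -> exists s, routed (branch x) (branch y) s.
Proof.
have direct (u v : V) : adj u v -> owner u v = [set u; v] -> exists s, routed u v s.
  move=> uv ow; exists (u :: rcons [::] v); apply: routed_path.
  - by apply/andP.
  - by rewrite /= inE andbT; apply: contraTneq uv => ->; rewrite adj_irrefl.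
  by rewrite /= ow eqxx.
case: x y => [[i j]|] [[i' j']|] // xy; try exact: direct.
have [ii|iN] := eqVneq i i'; last have [jj|jN] := eqVneq j j'.
- rewrite -ii in xy *; apply: route_row.
  by move: xy; rewrite eq_some xpair_eqE eqxx.
- by rewrite -jj; apply: route_col.
by apply: direct => //; rewrite /= /direct_adj /= /neq_rel !eq_some iN jN.
Qed.

Lemma branch_inj : injective branch.
Proof. by case=> [[i j]|] [[i' j']|] // [-> ->]. Qed.

Lemma option_product_immersion n :
  n = #|{: option (A * B)}| -> has_immersion V (complete n).
Proof.
move->; pose phi (u : 'I_#|{: option (A * B)}|) := branch (enum_val u).
(* The condition stays under the existential so that paths can be chosen for all u and v at once. *)
have route' u v : exists s, u != v -> routed (phi u) (phi v) s.
  have [->|uNv] := eqVneq u v; first by exists [::].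
  by have [|s] := @route (enum_val u) (enum_val v);
    [rewrite (inj_eq enum_val_inj) | exists s].
have [Q QP] := fin_all_exists (fun u => fin_all_exists (route' u)).
apply: (@immersion_of_owner _ _ phi Q owner).
- exact: inj_comp branch_inj enum_val_inj.
- exact: ownerC.
- by move=> u v /QP[].
- by move=> u v /QP[].
Qed.
End Routing.

(** * The two bounds for complete factors *)

Lemma product_immersion m n (p : pairing 'I_m) (q : pairing 'I_n) :
  has_immersion (direct_product (complete m.+1) (complete n.+1)) (complete (m * n).+1).
Proof.
pose f k (x : option 'I_k) : 'I_k.+1 := oapp (lift ord0) ord0 x.
have f_inj k : injective (@f k).
  by move=> [x|] [y|] //= /lift_inj->.
pose F (x : direct_product (complete_on (option 'I_m)) (complete_on (option 'I_n))) :
  direct_product (complete m.+1) (complete n.+1) := (f m x.1, f n x.2).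
apply: (immersion_hom (f := F) _ _ (option_product_immersion p q _)).
- by move=> [x y] [x' y'] [/f_inj-> /f_inj->].
- by move=> [x y] [x' y']; rewrite /= /direct_adj /= /complete_adj /neq_rel !(inj_eq (@f_inj _)).
by rewrite card_option card_prod !card_ord.
Qed.

Theorem theorem20 (t r : nat) (ht : 0 < t) (hr : 0 < r) :
  im (direct_product (complete t) (complete r)) = (t - 1) * (r - 1) + 1.
Proof.
apply/eqP; rewrite eqn_leq addn1; apply/andP; split.
  by apply: immersion_degree (im_immersion _) => v; rewrite product_degree.
apply: im_max; case: t r ht hr => [|m] [|n] // _ _; rewrite !subn1.
exact: product_immersion (ord_pairing m) (ord_pairing n).
Qed.
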